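(* Let $G$ be a finite group, let $S \subseteq G$ with $1 \notin S$ and $S^{-1} = S$, and let $C \subseteq G$ be closed under conjugation (i.e. $xCx^{-1} = C$ for all $x \in G$). Then the following are equivalent: (a) $C$ is a total perfect code in $\mathrm{Cay}(G, S)$; (b) there exists a pseudocovering $p: \mathrm{Cay}(G, S) \to K_{|S|}$ such that $gC$ is a fibre of $p$ for at least one element $g \in S$; (c) $|C|\,|S| = |G|$ and $C \cap \big((S^2 \setminus \{1\})C\big) = \emptyset$.
   Context: For a finite group $G$ and $S \subseteq G$ with $1 \notin S$ and $S^{-1}=S$, the Cayley graph $\mathrm{Cay}(G,S)$ has vertex set $G$, with $x, y$ adjacent iff $xy^{-1} \in S$. $S^2 = \{gg' : g, g' \in S\}$, and for $X, Y \subseteq G$, $XY = \{xy: x\in X, y \in Y\}$. A total perfect code in a graph is a set $C$ of vertices such that every vertex is adjacent to exactly one vertex of $C$. $K_n$ is the complete graph on $n$ vertices. A covering projection from $\Sigma$ to $\Gamma$ is a surjective map $p: V(\Sigma)\to V(\Gamma)$ whose restriction to each neighbourhood $\Sigma(u)$ is a bijection onto $\Gamma(p(u))$. A pseudocovering $p: \Sigma \to \Gamma$ is a surjective map $p: V(\Sigma) \to V(\Gamma)$ such that for each $v \in V(\Gamma)$ the induced subgraph $\Sigma[p^{-1}(v)]$ is a matching (each vertex of $p^{-1}(v)$ has exactly one neighbour in $p^{-1}(v)$), and $p$ is a covering projection from $\Sigma^*$ to $\Gamma$, where $\Sigma^*$ is obtained from $\Sigma$ by deleting the edges inside each fibre;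 the sets $p^{-1}(v)$ are the fibres of $p$. *)

(* Defs.v *)
From HB Require Import structures.
From mathcomp Require Import all_boot all_fingroup.

Set Implicit Arguments.
Unset Strict Implicit.
Unset Printing Implicit Defensive.

Local Open Scope group_scope.

(* A graph is given by its vertex type, a finType, and its adjacency relation. *)

Definition neighbourhood (V : finType) (e : rel V) (u : V) : {set V} :=
  [set v | e u v].

Definition total_perfect_code (V : finType) (e : rel V) (C : {set V}) : Prop :=
  forall x : V, exists! c : V, c \in C /\ e x c.

Definition complete_graph (n : nat) : rel 'I_n := fun i j => i != j.

Definition cayley (gT : finGroupType) (S : {set gT}) : rel gT :=
  fun x y => x * y^-1 \in S.

Lemma complete_graph_sym n : symmetric (@complete_graph n).
Proof. by move=> i j; rewrite /complete_graph eq_sym. Qed.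

Lemma complete_graph_irr n : irreflexive (@complete_graph n).
Proof. by move=> i; rewrite /complete_graph eqxx. Qed.

Lemma cayley_sym (gT : finGroupType) (S : {set gT}) :
  S^-1 = S -> symmetric (cayley S).
Proof. by move=> SV x y; rewrite /cayley -{1}SV inE invMg invgK. Qed.

Lemma cayley_irr (gT : finGroupType) (S : {set gT}) :
  1 \notin S -> irreflexive (cayley S).
Proof. by move=> S1 x; rewrite /cayley mulgV (negbTE S1). Qed.

Definition surjective (A B : Type) (f : A -> B) : Prop :=
  forall b : B, exists a : A, f a = b.

Definition fibre (V W : finType) (p : V -> W) (w : W) : {set V} :=
  [set v | p v == w].

Definition covering_projection (V W : finType) (sigma : rel V) (gamma : rel W)
    (p : V -> W) : Prop :=
  surjective p /\
  forall u : V, {in neighbourhood sigma u &, injective p} /\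
                p @: neighbourhood sigma u = neighbourhood gamma (p u).

Definition delete_fibre_edges (V W : finType) (sigma : rel V) (p : V -> W) :
  rel V := fun u v => sigma u v && (p u != p v).

Definition is_matching_on (V : finType) (e : rel V) (A : {set V}) : Prop :=
  forall u : V, u \in A -> exists! v : V, v \in A /\ e u v.

Definition pseudocovering (V W : finType) (sigma : rel V) (gamma : rel W)
    (p : V -> W) : Prop :=
  [/\ surjective p,
      forall w : W, is_matching_on sigma (fibre p w)
    & covering_projection (delete_fibre_edges sigma p) gamma p].

(* Main.v *)
(** Adjacency of [x] and [c] means [x = s * c] with [s \in S], so [C] is a total
    perfect code iff multiplication is a bijection from [setX S C] onto [G]; counting
    turns this into (c).  On the other side, a map onto a complete graph is a
    pseudocovering iff each of its fibres is a total perfect code.  Right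
    translations are automorphisms of the Cayley graph and [g C = C g], so all the
    sets [s C] with [s \in S] are total perfect codes as soon as [C] is; they
    partition [G] and are the fibres of the pseudocovering in (b). *)

Require Import Defs.
From HB Require Import structures.
From mathcomp Require Import all_boot all_fingroup.

Set Implicit Arguments.
Unset Strict Implicit.
Unset Printing Implicit Defensive.

Local Open Scope group_scope.

(** For a vertex inside the fibre over [w], the unique neighbour there is the matching condition.
    For a vertex [u] outside it, [w] is adjacent to [p u] in the complete graph, so the covering
    condition gives exactly one neighbour over [w]. *)
Lemma pseudocovering_completeP (V : finType) (e : rel V) (n : nat)
    (p : V -> 'I_n) :
  pseudocovering e (@complete_graph n) p <->
  surjective p /\ forall w, total_perfect_code e (fibre p w).
Proof.
split=> [[p_surj p_match [_ p_cov]] | [p_surj p_tpc]].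
  split=> // w u; have [uw | uNw] := eqVneq (p u) w.
    by apply: p_match; rewrite inE uw.
  have [p_inj p_im] := p_cov u.
  have: w \in p @: neighbourhood (delete_fibre_edges e p) u.
    by rewrite p_im inE.
  case/imsetP=> v v_nb w_v; exists v; split.
    by move: v_nb; rewrite !inE w_v eqxx => /andP[].
  move=> v' []; rewrite inE => /eqP v'w uv'; apply: p_inj => //.
    by rewrite inE /delete_fibre_edges uv' v'w.
  by rewrite v'w.
split=> // [w u _|]; first exact: p_tpc.
split=> // u; split=> [v v' | ].
  rewrite !inE => /andP[uv _] /andP[uv' _] vv'.
  have [z [_ z_uniq]] := p_tpc (p v) u.
  by rewrite -(z_uniq v) ?(z_uniq v') // inE ?vv' eqxx.
apply/setP=> w; apply/imsetP/idP=> [[v] | ].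
  by rewrite !inE => /andP[_ uNv] ->.
rewrite inE => uNw; have [v [[]]] := p_tpc w u.
rewrite inE => /eqP vw uv _; exists v => //.
by rewrite inE /delete_fibre_edges uv vw.
Qed.

Section CayleyCodes.

Variables (gT : finGroupType) (S C : {set gT}).

Lemma total_perfect_code_rcoset (g : gT) :
  total_perfect_code (cayley S) C -> total_perfect_code (cayley S) (C :* g).
Proof.
move=> C_tpc x; have [c [[cC xc] c_uniq]] := C_tpc (x * g^-1).
exists (c * g); split.
  by rewrite mem_rcoset mulgK; split=> //; rewrite /cayley invMg mulgA.
move=> d []; rewrite mem_rcoset => dC xd.
rewrite (c_uniq (d * g^-1)) ?mulgKV //; split=> //.
by rewrite /cayley invMg invgK mulgA mulgKV.
Qed.

Lemma conj_closed_lcoset (g : gT) :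
  (forall x, [set x * c * x^-1 | c in C] = C) -> g *: C = C :* g.
Proof.
(* Only the right-hand [C] becomes its conjugate by [g]; cancelling [g^-1] in
   [x * g^-1 = g * c * g^-1] leaves [x = g * c]. *)
move=> CJ; apply/setP=> x; rewrite mem_lcoset mem_rcoset -{2}(CJ g).
apply/idP/imsetP=> [xC | [c cC /mulIg ->]].
  by exists (g^-1 * x) => //; rewrite mulKVg.
by rewrite mulKg.
Qed.

Lemma total_perfect_code_factorP :
  total_perfect_code (cayley S) C <->
  {in setX S C &, injective (fun u => u.1 * u.2)} /\
  [set u.1 * u.2 | u in setX S C] = setT.
Proof.
split=> [C_tpc | [m_inj m_im] x].
  split=> [[s c] [t d] | ].
    rewrite !inE /= => /andP[sS cC] /andP[tS dC] sc_td.
    have [z [_ z_uniq]] := C_tpc (s * c).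
    (* Both [c] and [d] are neighbours in [C] of the common product. *)
    have zc : z = c by apply: z_uniq; rewrite /cayley mulgK.
    have zd : z = d by apply: z_uniq; rewrite /cayley sc_td mulgK.
    by move: sc_td; rewrite -zc -zd => /mulIg ->.
  apply/setP=> x; rewrite inE; have [c [[cC xc] _]] := C_tpc x.
  apply/imsetP; exists (x * c^-1, c); last by rewrite /= mulgKV.
  by rewrite !inE /= cC andbT.
have: x \in [set u.1 * u.2 | u in setX S C] by rewrite m_im inE.
case/imsetP=> [[s c]]; rewrite !inE /= => /andP[sS cC] ->.
exists c; split=> [|d [dC cd]]; first by rewrite /cayley mulgK.
suff [] : (s, c) = (s * c * d^-1, d) by [].
by apply: m_inj; rewrite ?inE /= ?sS ?dC ?mulgKV // andbT.
Qed.

(** A collision [s * c = t * d] reads [c = (s^-1 * t) * d] with [s^-1 * t] in [S * S], so the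
    disjointness condition is injectivity of multiplication; the cardinality equation then makes it
    surjective. *)
Lemma total_perfect_code_cardP (SV : S^-1 = S) :
  total_perfect_code (cayley S) C <->
  (#|C| * #|S|)%N = #|gT| /\ C :&: (((S * S) :\ 1) * C) = set0.
Proof.
split=> [/total_perfect_code_factorP[m_inj m_im] | [cardCS CSSC]].
  split; first by rewrite mulnC -cardsX -(card_in_imset m_inj) m_im cardsT.
  apply/setP=> c; rewrite !inE; apply/negP=> /andP[cC].
  case/mulsgP=> a d; rewrite !inE => /andP[aN1 /mulsgP[s t sS tS def_a]] dC def_c.
  case/eqP: aN1; rewrite def_a.
  (* From [c = s * t * d] come two factorizations [s^-1 * c = t * d] of one element. *)
  suff [<- _] : (s^-1, c) = (t, d) by rewrite mulgV.
  apply: m_inj; rewrite ?inE /= ?tS ?cC ?dC ?andbT //.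
    by rewrite -SV inE invgK.
  by rewrite def_c def_a !mulgA mulVg mul1g.
have m_inj : {in setX S C &, injective (fun u => u.1 * u.2)}.
  move=> [s c] [t d]; rewrite !inE /= => /andP[sS cC] /andP[tS dC] sc_td.
  have def_c : c = s^-1 * t * d by rewrite -mulgA -sc_td mulKg.
  have [st1 | stN1] := eqVneq (s^-1 * t) 1.
    by rewrite def_c st1 mul1g -[t](mulKVg s) st1 mulg1.
  suff: c \in C :&: (((S * S) :\ 1) * C) by rewrite CSSC inE.
  rewrite inE cC def_c mem_mulg // !inE stN1 mem_mulg //.
  by rewrite -SV inE invgK.
apply/total_perfect_code_factorP; split=> //.
apply/eqP; rewrite eqEcard subsetT cardsT.
by rewrite (card_in_imset m_inj) cardsX mulnC cardCS leqnn.
Qed.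

Lemma lcoset_fibration (g : gT) :
  g \in S -> total_perfect_code (cayley S) C ->
  exists p : gT -> 'I_#|S|, forall w, fibre p w = enum_val w *: C.
Proof.
(* [s x] is the [S]-factor of [x]; [sP] shows that the default 1 is never returned. The element [g]
   serves as the inhabitant required by [enum_rank_in]. *)
move=> gS C_tpc; pose s x := odflt 1 [pick s in S | s^-1 * x \in C].
have [m_inj _] := total_perfect_code_factorP.1 C_tpc.
have sP x : s x \in S /\ (s x)^-1 * x \in C.
  rewrite /s; case: pickP => [t /andP[] // | none].
  have [c [[cC xc] _]] := C_tpc x.
  by have:= none (x * c^-1); rewrite [_ \in S]xc invMg invgK mulgKV cC.
exists (fun x => enum_rank_in gS (s x)) => w; apply/setP=> x.
have [sS sC] := sP x; rewrite inE mem_lcoset; apply/eqP/idP=> [<- | xC].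
  by rewrite enum_rankK_in.
apply: enum_val_inj; rewrite enum_rankK_in //.
suff [] : (s x, (s x)^-1 * x) = (enum_val w, (enum_val w)^-1 * x) by [].
by apply: m_inj; rewrite ?inE /= ?sS ?enum_valP ?mulKVg.
Qed.

End CayleyCodes.

Theorem theorem3p3 (gT : finGroupType) (S C : {set gT})
    (S1 : 1 \notin S) (SV : S^-1 = S)
    (CJ : forall x : gT, [set x * c * x^-1 | c in C] = C) :
  let a := total_perfect_code (cayley S) C in
  let b := exists p : gT -> 'I_#|S|,
      pseudocovering (cayley S) (@complete_graph #|S|) p /\
      exists2 g : gT, g \in S & exists v : 'I_#|S|, fibre p v = g *: C in
  let c := (#|C| * #|S|)%N = #|gT| /\ C :&: (((S * S) :\ 1) * C) = set0 in
  (a <-> b) /\ (b <-> c).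
Proof.
have tpc_pseudo : total_perfect_code (cayley S) C <->
    exists p : gT -> 'I_#|S|,
      pseudocovering (cayley S) (@complete_graph #|S|) p /\
      exists2 g : gT, g \in S & exists v : 'I_#|S|, fibre p v = g *: C.
  split=> [C_tpc | [p [/pseudocovering_completeP[_ p_tpc] [g _ [v pv]]]]].
    (* The neighbour [c] of 1 in [C] has [c^-1] in [S], which provides the [g] of (b); [c] itself
       shows that every fibre is nonempty. *)
    have [c [[cC]]] := C_tpc 1; rewrite /cayley mul1g => gS _.
    have [p p_fib] := lcoset_fibration gS C_tpc.
    exists p; split; last first.
      exists c^-1 => //; exists (enum_rank_in gS c^-1).
      by rewrite p_fib enum_rankK_in.
    apply/pseudocovering_completeP; split=> w.
      exists (enum_val w * c); apply/eqP.
      have /setP/(_ (enum_val w * c)) := p_fib w.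
      by rewrite mem_lcoset mulKg cC inE.
    by rewrite p_fib conj_closed_lcoset //; apply: total_perfect_code_rcoset.
  (* Conversely, the fibre is [C :* g], and translating it by [g^-1] recovers [C]. *)
  have:= p_tpc v; rewrite pv conj_closed_lcoset //.
  by move/(total_perfect_code_rcoset g^-1); rewrite rcosetK.
split=> //; apply: iff_trans (iff_sym tpc_pseudo) _.
exact: total_perfect_code_cardP.
Qed.
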